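(* Let $\mathcal{C}$ be a Cayley algebra over an arbitrary field $\mathbb{F}$ with norm $\mathrm{n}$, and let $\mathrm{O}(\mathcal{C},\mathrm{n})$ be the orthogonal group of $(\mathcal{C},\mathrm{n})$. Then the set $\mathrm{LocAut}(\mathcal{C})$ of local automorphisms of $\mathcal{C}$ coincides with $\{\varphi\in\mathrm{O}(\mathcal{C},\mathrm{n})\mid \varphi(1)=1\}$.
   Context: A Cayley (octonion) algebra over $\mathbb{F}$ is a unital nonassociative algebra $\mathcal{C}$ of dimension $8$ over $\mathbb{F}$ endowed with a quadratic form $\mathrm{n}:\mathcal{C}\to\mathbb{F}$ (the norm) such that $\mathrm{n}(xy)=\mathrm{n}(x)\mathrm{n}(y)$ for all $x,y$ and whose polar form $\mathrm{n}(x,y)=\mathrm{n}(x+y)-\mathrm{n}(x)-\mathrm{n}(y)$ is a nondegenerate bilinear form. $\mathrm{O}(\mathcal{C},\mathrm{n})$ is the group of linear bijections $\varphi$ of $\mathcal{C}$ with $\mathrm{n}(\varphi(x))=\mathrm{n}(x)$ for all $x$. A linear map $\psi:\mathcal{C}\to\mathcal{C}$ is a local automorphism if for every $x\in\mathcal{C}$ there is an algebra automorphism $\varphi_x$ of $\mathcal{C}$ (depending on $x$) with $\psi(x)=\varphi_x(x)$. *)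

(* Defs.v *)
From HB Require Import structures.
From mathcomp Require Import all_boot all_order all_algebra.
Set Implicit Arguments. Unset Strict Implicit. Unset Printing Implicit Defensive.
Import GRing.Theory.
Local Open Scope ring_scope.

Section Cayley.
Variables (F : fieldType) (C : vectType F).

Definition is_linear (f : C -> C) : Prop :=
  forall (a : F) (x y : C), f (a *: x + y) = a *: f x + f y.

Definition is_bilinear (mul : C -> C -> C) : Prop :=
  (forall y, is_linear (fun x => mul x y)) /\ (forall x, is_linear (mul x)).

Definition polar (n : C -> F) (x y : C) : F := n (x + y) - n x - n y.

(* n is a quadratic form: n(a x) = a^2 n(x) and its polar form is bilinear
   (symmetric by construction, so linearity in the first argument suffices) *)
Definition is_quadratic_form (n : C -> F) : Prop :=
  (forall (a : F) x, n (a *: x) = a ^+ 2 * n x) /\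
  (forall (a : F) x y z, polar n (a *: x + y) z = a * polar n x z + polar n y z).

Definition nondegenerate (n : C -> F) : Prop :=
  forall x, (forall y, polar n x y = 0) -> x = 0.

Definition cayley_algebra (mul : C -> C -> C) (one : C) (n : C -> F) : Prop :=
  [/\ \dim (fullv : {vspace C}) = 8%N,
      is_bilinear mul &
      [/\
      (forall x, mul one x = x /\ mul x one = x),
      is_quadratic_form n,
      (forall x y, n (mul x y) = n x * n y)
    & nondegenerate n]].

Definition is_automorphism (mul : C -> C -> C) (phi : C -> C) : Prop :=
  [/\ is_linear phi, bijective phi & forall x y, phi (mul x y) = mul (phi x) (phi y)].

Definition is_local_automorphism (mul : C -> C -> C) (psi : C -> C) : Prop :=
  is_linear psi /\
  forall x, exists phi, is_automorphism mul phi /\ psi x = phi x.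

Definition in_orthogonal_group (n : C -> F) (phi : C -> C) : Prop :=
  [/\ is_linear phi, bijective phi & forall x, n (phi x) = n x].

End Cayley.

(* Main.v *)
(* The quadratic equation z^2 - t(z) z + n(z) 1 = 0 makes every automorphism an
   isometry fixing 1, which gives one inclusion.  Conversely let phi be such an
   isometry, x a nonscalar element and y = phi x.  One can choose a with t(a) = 0
   such that 1, x, a, xa span a quaternion subalgebra Q with nondegenerate norm,
   and then b orthogonal to Q with n(b) <> 0, so that C = Q + Qb is a
   Cayley-Dickson double: in the basis so obtained the multiplication table only
   depends on n(x), t(x), n(a), n(x, a) and n(b).  With a' = phi a, the elements
   1, y, a', ya' span a quaternion subalgebra Q' with the same table, and it
   remains to find b' orthogonal to Q' with n(b') = n(b), for then the linear map
   matching the two bases is an automorphism sending x to y.  If n is isotropic,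
   both b and b' can be chosen of norm -1; if n is anisotropic, composing phi with
   a reflection makes it map Q onto Q', and b' is the image of b. *)

Require Import Defs.
From Stdlib Require Import Classical.
From HB Require Import structures.
From mathcomp Require Import all_boot all_order all_algebra.
From mathcomp Require Import ring.
Set Implicit Arguments. Unset Strict Implicit. Unset Printing Implicit Defensive.
Import GRing.Theory.
Local Open Scope ring_scope.

(** * Linear maps between finite-dimensional spaces *)

Lemma hom_of_linear (F : fieldType) (U V : vectType F) (f : U -> V) :
  linear f -> exists h : 'Hom(U, V), h =1 f.
Proof.
move=> lf; pose ff : {linear U -> V} := HB.pack f (GRing.isLinear.Build F U V *:%R f lf).
by exists (linfun ff) => x; rewrite lfunE.
Qed.

Lemma hom_kernel_nontrivial (F : fieldType) (U V : vectType F) (h : 'Hom(U, V)) :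
  (dim V < dim U)%N -> exists2 u, u != 0 & h u = 0.
Proof.
move=> ltVU; exists (vpick (lker h)); last by apply/eqP; rewrite -memv_ker memv_pick.
rewrite vpick0 -dimv_eq0 -lt0n.
have := limg_ker_dim h fullv; rewrite capfv (dimvf U) => eU.
have : (\dim (limg h) <= dim V)%N by rewrite -dimvf dimvS ?subvf.
move=> leV; move: ltVU; rewrite -eU.
by case: (\dim (lker h)) => //; rewrite add0n ltnNge leV.
Qed.

Lemma injective_hom_bijective (F : fieldType) (U V : vectType F) (h : 'Hom(U, V)) :
  dim U = dim V -> (forall u, h u = 0 -> u = 0) ->
  cancel h h^-1%VF /\ cancel h^-1%VF h.
Proof.
move=> eUV hinj.
have ker0 : lker h == 0%VS.
  apply/lker0P => u v huv; apply/eqP; rewrite -subr_eq0; apply/eqP/hinj.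
  by rewrite linearB /= huv subrr.
split; first exact: lker0_lfunK.
move=> v; apply: limg_lfunVK.
suff /eqP-> : limg h == fullv by rewrite memvf.
have dimh : \dim (limg h) = dim V.
  by rewrite -eUV -(dimvf U); apply: limg_dim_eq; rewrite (eqP ker0) capv0.
by rewrite eqEdim subvf dimvf dimh leqnn.
Qed.

Lemma linear_mapZ (F : fieldType) (C : vectType F) (f : C -> C) (k : F) u :
  is_linear f -> f (k *: u) = k *: f u.
Proof. by move=> lin; have [h hE] := hom_of_linear lin; rewrite -!hE linearZ. Qed.

(** Turns a known equation into a new one, leaving a pure identity between differences. *)
Lemma eq_by_diff (V : zmodType) (u v u' v' : V) : u' = v' -> u - v = u' - v' -> u = v.
Proof. by move=> -> /eqP; rewrite subrr subr_eq0 => /eqP. Qed.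

(** * Multiplication tables in coordinates *)

Section Coordinates.

Variable F : fieldType.

Definition quad : vectType F := ((F^o * F^o) * (F^o * F^o))%type.
Definition octuple : vectType F := (quad * quad)%type.

Variables T N M m : F.

(* Multiplication table of the basis 1, x, a, xa when x has trace T and norm N,
   a has trace 0 and norm M, and n(x, a) = m. *)
Definition quad_mul (c d : quad) : quad :=
  let: ((c0, c1), (c2, c3)) := c in let: ((d0, d1), (d2, d3)) := d in
  ((c0 * d0 - N * c1 * d1 - m * c2 * d1 - M * c2 * d2 - T * M * c2 * d3
      - N * M * c3 * d3,
    c0 * d1 + c1 * d0 + T * c1 * d1 + M * c2 * d3 - m * c3 * d1 - M * c3 * d2),
   (c0 * d2 + c2 * d0 - N * c1 * d3 + T * c2 * d1 - m * c2 * d3 + N * c3 * d1,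
    c0 * d3 + c3 * d0 + c1 * d2 + T * c1 * d3 - c2 * d1 - m * c3 * d3)).

(** This is [t(z) 1 - z] in coordinates: the traces of 1, x, a, xa are [2], [T], [0] and [- m]. *)
Definition quad_conj (c : quad) : quad :=
  let: ((c0, c1), (c2, c3)) := c in
  ((c0 + T * c1 - m * c3, - c1), (- c2, - c3)).

(** The Cayley-Dickson product, a pair [(q, r)] standing for q + rb with [beta] = n(b). *)
Definition octuple_mul (beta : F) (u v : octuple) : octuple :=
  (quad_mul u.1 v.1 - beta *: quad_mul (quad_conj v.2) u.2,
   quad_mul v.2 u.1 + quad_mul u.2 (quad_conj v.1)).

End Coordinates.

(** * Identities of composition algebras *)

Section CompositionAlgebra.

Variables (F : fieldType) (C : vectType F).
Variables (mul : C -> C -> C) (one : C) (n : C -> F).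
Hypothesis cayley : cayley_algebra mul one n.

Local Notation "x ** y" := (mul x y) (at level 40, left associativity).
Local Notation B := (polar n).
Local Notation t := (polar n one).

Lemma dim_cayley : dim C = 8%N.
Proof. by case: cayley => dC _ _; rewrite -dimvf. Qed.

Lemma mul1x x : one ** x = x.
Proof. by case: cayley => _ _ [h _ _ _]; case: (h x). Qed.

Lemma mulx1 x : x ** one = x.
Proof. by case: cayley => _ _ [h _ _ _]; case: (h x). Qed.

Lemma norm_mul x y : n (x ** y) = n x * n y.
Proof. by case: cayley => _ _ [_ _ h _]. Qed.

Lemma normZ (a : F) x : n (a *: x) = a ^+ 2 * n x.
Proof. by case: cayley => _ _ [_ [h _] _ _]. Qed.

Lemma mul_linl (a : F) x y z : (a *: x + y) ** z = a *: (x ** z) + y ** z.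
Proof. by case: cayley => _ [h _] _; apply: h. Qed.

Lemma mul_linr (a : F) x y z : z ** (a *: x + y) = a *: (z ** x) + z ** y.
Proof. by case: cayley => _ [_ h] _; apply: h. Qed.

Lemma polar_linl (a : F) x y z : B (a *: x + y) z = a * B x z + B y z.
Proof. by case: cayley => _ _ [_ [_ h] _ _]. Qed.

Lemma nondeg x : (forall y, B x y = 0) -> x = 0.
Proof. by case: cayley => _ _ [_ _ _]; apply. Qed.

Lemma mulDl x y z : (x + y) ** z = x ** z + y ** z.
Proof. by have := mul_linl 1 x y z; rewrite !scale1r. Qed.
Lemma mulDr z x y : z ** (x + y) = z ** x + z ** y.
Proof. by have := mul_linr 1 x y z; rewrite !scale1r. Qed.
Lemma mul0x x : 0 ** x = 0.
Proof. by have := mulDl 0 0 x; rewrite addr0 => /esym/eqP; rewrite -subr_eq0 addrK => /eqP. Qed.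
Lemma mulx0 x : x ** 0 = 0.
Proof. by have := mulDr x 0 0; rewrite addr0 => /esym/eqP; rewrite -subr_eq0 addrK => /eqP. Qed.
Lemma mulZl (a : F) x y : (a *: x) ** y = a *: (x ** y).
Proof. by have := mul_linl a x 0 y; rewrite mul0x !addr0. Qed.
Lemma mulZr (a : F) x y : x ** (a *: y) = a *: (x ** y).
Proof. by have := mul_linr a y 0 x; rewrite mulx0 !addr0. Qed.
Lemma mul_oppl x y : (- x) ** y = - (x ** y).
Proof. by rewrite -scaleN1r mulZl scaleN1r. Qed.
Lemma mul_oppr x y : x ** (- y) = - (x ** y).
Proof. by rewrite -scaleN1r mulZr scaleN1r. Qed.

Lemma polarC x y : B x y = B y x.
Proof. by rewrite /polar [y + x]addrC addrAC. Qed.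
Lemma polarDl x y z : B (x + y) z = B x z + B y z.
Proof. by have := polar_linl 1 x y z; rewrite scale1r mul1r. Qed.
Lemma polar0l x : B 0 x = 0.
Proof. by have := polarDl 0 0 x; rewrite addr0 => /esym/eqP; rewrite -subr_eq0 addrK => /eqP. Qed.
Lemma polarZl (a : F) x y : B (a *: x) y = a * B x y.
Proof. by have := polar_linl a x 0 y; rewrite polar0l !addr0. Qed.
Lemma polarNl x y : B (- x) y = - B x y.
Proof. by rewrite -scaleN1r polarZl mulN1r. Qed.
Lemma polarDr z x y : B z (x + y) = B z x + B z y.
Proof. by rewrite polarC polarDl !(polarC z). Qed.
Lemma polar0r x : B x 0 = 0.
Proof. by rewrite polarC polar0l. Qed.
Lemma polarZr (a : F) x y : B x (a *: y) = a * B x y.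
Proof. by rewrite polarC polarZl polarC. Qed.
Lemma polarNr x y : B x (- y) = - B x y.
Proof. by rewrite polarC polarNl polarC. Qed.
Lemma normD x y : n (x + y) = n x + n y + B x y.
Proof. by rewrite /polar; ring. Qed.
Lemma normN x : n (- x) = n x.
Proof. by rewrite -scaleN1r normZ sqrrN expr1n mul1r. Qed.
Lemma polarxx x : B x x = 2 * n x.
Proof.
have -> : B x x = n (2 *: x) - 2 * n x by rewrite scaler_nat mulr2n /polar; ring.
by rewrite normZ; ring.
Qed.

Definition mulE := (mulDl, mulDr, mulZl, mulZr, mul_oppl, mul_oppr, mul1x, mulx1, mul0x, mulx0).
Definition polarE :=
  (polarDl, polarDr, polarZl, polarZr, polarNl, polarNr, polar0l, polar0r).

Lemma polar_inj x y : (forall z, B x z = B y z) -> x = y.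
Proof.
move=> h; apply/eqP; rewrite -subr_eq0; apply/eqP/nondeg => z.
by rewrite !polarE h subrr.
Qed.

(** Nondegeneracy reduces a vector identity to a scalar one, by pairing both sides with an arbitrary
    vector; [ring] then applies. *)
Ltac linear_ring := apply: polar_inj => ?; rewrite !polarE; ring.

Ltac linear_ring_from e := apply: (eq_by_diff e); linear_ring.

Lemma one_neq0 : one != 0.
Proof.
apply/negP => /eqP e1; have x0 x : x = 0 :> C by rewrite -[x]mul1x e1 mul0x.
have : (fullv : {vspace C}) == 0%VS.
  by rewrite -subv0; apply/subvP => u _; rewrite (x0 u) mem0v.
by rewrite -dimv_eq0 dimvf dim_cayley.
Qed.

Lemma norm1 : n one = 1.
Proof.
have := norm_mul one one; rewrite mul1x => /eqP.
rewrite -{1}[n one]mulr1 -subr_eq0 -mulrBr mulf_eq0 subr_eq0.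
case/orP => /eqP // n10.
have n0 x : n x = 0 by rewrite -[x]mul1x norm_mul n10 mul0r.
by case/eqP: one_neq0; apply: nondeg => y; rewrite /polar !n0 !subr0.
Qed.

Lemma polar11 : t one = 2.
Proof. by rewrite polarxx norm1 mulr1. Qed.

Lemma polar_mull x y z : B (x ** y) (x ** z) = n x * B y z.
Proof. by rewrite /polar -mulDr !norm_mul; ring. Qed.

Lemma polar_mulr x y z : B (y ** x) (z ** x) = B y z * n x.
Proof. by rewrite /polar -mulDl !norm_mul; ring. Qed.

(** Linearization of [polar_mulr] in the common factor, replaced by [y + w]. *)
Lemma polar_mul_exchange x y z w :
  B (x ** y) (z ** w) + B (z ** y) (x ** w) = B x z * B y w.
Proof.
have := polar_mulr (y + w) x z; rewrite normD !mulE !polarE.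
rewrite !polar_mulr [B (x ** w) (z ** y)]polarC => e.
by apply/(addrI (B x z * n y + B x z * n w)); rewrite -mulrDr -[RHS]mulrDr -e; ring.
Qed.

Definition conj x : C := t x *: one - x.

(** The exchange identity with one factor equal to [one]: the adjoint of a multiplication is
    multiplication by the conjugate. *)
Lemma polar_adjl x y z : B (x ** y) z = B y (conj x ** z).
Proof.
rewrite /conj !mulE !polarE (polarC one x) -polar_mul_exchange !mul1x.
ring.
Qed.

Lemma polar_adjr x y z : B (y ** x) z = B y (z ** conj x).
Proof.
have := polar_mul_exchange y x z one; rewrite !mulx1 => e.
by rewrite /conj !mulE !polarE (polarC one x) [_ * B y z]mulrC -e [B (z ** x) y]polarC; ring.
Qed.

(** The left alternative law, with x² already replaced by means of the quadratic equation. The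
    adjoint of left multiplication by [x] is also its inverse up to the factor [n x]. *)
Lemma mul_left_sq x y : x ** (x ** y) = t x *: (x ** y) - n x *: y.
Proof.
suff e : conj x ** (x ** y) = n x *: y.
  by rewrite -e /conj !mulE; linear_ring.
by apply: polar_inj => z; rewrite polarC -polar_adjl polar_mull polarZl (polarC z).
Qed.

Lemma mul_right_sq x y : (y ** x) ** x = t x *: (y ** x) - n x *: y.
Proof.
suff e : (y ** x) ** conj x = n x *: y.
  by rewrite -e /conj !mulE; linear_ring.
apply: polar_inj => z; rewrite polarC -polar_adjr polar_mulr polarZl (polarC z).
exact: mulrC.
Qed.

Lemma mul_sq x : x ** x = t x *: x - n x *: one.
Proof. by have := mul_left_sq x one; rewrite mulx1. Qed.

(** Linearization of [mul_left_sq] in [x]. With its mirror image it stands in for associativity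
    below. *)
Lemma mul_left_sym x y z :
  x ** (y ** z) + y ** (x ** z) = t x *: (y ** z) + t y *: (x ** z) - B x y *: z.
Proof.
have := mul_left_sq (x + y) z; rewrite !mulE !mul_left_sq normD => e.
linear_ring_from e.
Qed.

Lemma mul_right_sym x y z :
  (z ** x) ** y + (z ** y) ** x = t x *: (z ** y) + t y *: (z ** x) - B x y *: z.
Proof.
have := mul_right_sq (x + y) z; rewrite !mulE !mul_right_sq normD => e.
linear_ring_from e.
Qed.

Lemma mul_sym x y : x ** y + y ** x = t x *: y + t y *: x - B x y *: one.
Proof. by have := mul_left_sym x y one; rewrite !mulx1. Qed.

Lemma conjM x y : conj (x ** y) = conj y ** conj x.
Proof.
apply: polar_inj => z.
have := congr1 (B^~ z) (mul_sym x y); rewrite /conj !mulE !polarE.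
rewrite [B one (x ** y)]polarC (polar_adjl x y one) /conj !mulE !polarE (polarC y one) (polarC y x).
by move=> e; apply: (eq_by_diff (esym e)); ring.
Qed.

(** * Cayley-Dickson doubling of a subalgebra by an orthogonal vector *)

Section Doubling.

Variables (Q : C -> Prop) (b : C).
Hypothesis QM : forall q r, Q q -> Q r -> Q (q ** r).
Hypothesis Qconj : forall q, Q q -> Q (conj q).
Hypothesis Q1 : Q one.
Hypothesis bQ : forall q, Q q -> B q b = 0.

Let tb : t b = 0. Proof. exact: bQ. Qed.

Lemma doubling_polar q r : Q q -> Q r -> B q (r ** b) = 0.
Proof.
by move=> Qq Qr; rewrite polarC polar_adjl polarC bQ //; apply/QM/Qq/Qconj.
Qed.

Lemma doubling_swap q : Q q -> q ** b = b ** conj q.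
Proof.
move=> Qq; have := mul_sym q b.
by rewrite tb bQ // !scale0r addr0 subr0 /conj !mulE => e; linear_ring_from e.
Qed.

(** Once [b] is moved to the left by [doubling_swap], this is [mul_left_sym] for [q], [b] and
    [conj r], where [b] has trace 0 and is orthogonal to [q]. *)
Lemma doubling_mulQ q r : Q q -> Q r -> q ** (r ** b) = (r ** q) ** b.
Proof.
move=> Qq Qr; rewrite !doubling_swap //; last exact: QM.
have := mul_left_sym q b (conj r).
rewrite tb bQ // !scale0r addr0 subr0 conjM {1 3}/conj !mulE => e.
linear_ring_from e.
Qed.

Lemma doubling_Qmul q r : Q r -> (q ** b) ** r = (q ** conj r) ** b.
Proof.
move=> Qr; have := mul_right_sym b r q.
rewrite tb [B b r]polarC bQ // !scale0r add0r subr0 /conj !mulE => e.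
linear_ring_from e.
Qed.

Lemma doubling_mul q r : Q q -> Q r -> (q ** b) ** (r ** b) = (- n b) *: (conj r ** q).
Proof.
move=> Qq Qr; have := mul_left_sym (q ** b) r b.
rewrite mul_right_sq tb (doubling_polar Q1 Qq) [B (q ** b) r]polarC doubling_polar //.
rewrite /conj !mulE => e; linear_ring_from e.
Qed.

End Doubling.


(** * From coordinates to elements of the algebra *)

Definition quad_eval x a (c : quad F) : C :=
  let: ((c0, c1), (c2, c3)) := c in
  c0 *: one + c1 *: x + c2 *: a + c3 *: (x ** a).

Arguments quad_eval : simpl never.

Definition octuple_eval x a b (v : octuple F) : C :=
  quad_eval x a v.1 + quad_eval x a v.2 ** b.

Lemma quad_eval_linear x a (k : F) c d :
  quad_eval x a (k *: c + d) = k *: quad_eval x a c + quad_eval x a d.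
Proof.
case: c => [[c0 c1] [c2 c3]]; case: d => [[d0 d1] [d2 d3]].
have regular_scale (c : F^o) : k *: c = k * c by [].
by rewrite /quad_eval /= !regular_scale; linear_ring.
Qed.

Lemma quad_evalD x a c d : quad_eval x a (c + d) = quad_eval x a c + quad_eval x a d.
Proof. by have := quad_eval_linear x a 1 c d; rewrite !scale1r. Qed.

Lemma quad_eval0 x a : quad_eval x a 0 = 0.
Proof. by rewrite /quad_eval /= !scale0r !addr0. Qed.

Lemma quad_evalZ x a (k : F) c : quad_eval x a (k *: c) = k *: quad_eval x a c.
Proof. by have := quad_eval_linear x a k c 0; rewrite quad_eval0 !addr0. Qed.

Lemma octuple_eval_linear x a b : linear (octuple_eval x a b).
Proof.
move=> k [u1 u2] [v1 v2].
rewrite /octuple_eval -[(k *: _ + _).1]/(k *: u1 + v1) -[(k *: _ + _).2]/(k *: u2 + v2).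
rewrite !quad_eval_linear !mulE.
linear_ring.
Qed.

(** * The quaternion subalgebra spanned by 1, x, a, xa *)

Section Quaternion.

Variables x a : C.
Hypothesis ta : t a = 0.
Let ta' : B a one = 0. Proof. by rewrite polarC. Qed.

Local Notation T := (t x).
Local Notation N := (n x).
Local Notation M := (n a).
Local Notation m := (B x a).
Local Notation Q := (quad_eval x a).
Local Notation disc := ((4 * N - T ^+ 2) * M - m ^+ 2).

(** The products of basis vectors come from the quadratic equation and the linearized alternative
    laws, so associativity of the span is never assumed. *)
Let ax : a ** x = T *: a - x ** a - m *: one.
Proof. by have := mul_sym x a; rewrite ta => e; linear_ring_from e. Qed.

Let aa : a ** a = - M *: one.
Proof. by rewrite mul_sq ta; linear_ring. Qed.

Let x_xa : x ** (x ** a) = T *: (x ** a) - N *: a.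
Proof. exact: mul_left_sq. Qed.

Let xa_a : (x ** a) ** a = - M *: x.
Proof. by rewrite mul_right_sq ta; linear_ring. Qed.

Let a_xa : a ** (x ** a) = M *: x - m *: a - T * M *: one.
Proof.
by have := mul_left_sym x a a; rewrite ta !aa !mulE => e; linear_ring_from e.
Qed.

Let xa_x : (x ** a) ** x = N *: a - m *: x.
Proof.
have := mul_right_sym x a x; rewrite ta mul_sq !mulE => e.
linear_ring_from e.
Qed.

Let txa : t (x ** a) = - m.
Proof. by rewrite polarC polar_adjl /conj !mulE !polarE ta' (polarC a x); ring. Qed.

Let xa_xa : (x ** a) ** (x ** a) = - m *: (x ** a) - N * M *: one.
Proof. by rewrite mul_sq txa norm_mul. Qed.

Let tableE := (ax, aa, x_xa, xa_a, a_xa, xa_x, xa_xa, mul_sq x).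

Lemma quad_evalM c d : Q c ** Q d = Q (quad_mul T N M m c d).
Proof.
case: c => [[c0 c1] [c2 c3]]; case: d => [[d0 d1] [d2 d3]].
by rewrite /quad_eval /= !mulE !tableE; linear_ring.
Qed.

Lemma quad_eval_conj c : conj (Q c) = Q (quad_conj T m c).
Proof.
case: c => [[c0 c1] [c2 c3]].
by rewrite /conj /quad_eval /= !polarE ta txa polar11; linear_ring.
Qed.

Let B_x_xa : B x (x ** a) = 0.
Proof. by rewrite -{1}[x]mulx1 polar_mull ta mulr0. Qed.

Let B_a_xa : B a (x ** a) = T * M.
Proof. by rewrite -{1}[a]mul1x polar_mulr. Qed.

Let B_xa_xa : B (x ** a) (x ** a) = 2 * (N * M).
Proof. by rewrite polarxx norm_mul. Qed.

Let gramE := (polar11, ta, ta', txa, B_x_xa, B_a_xa, B_xa_xa, polarxx x, polarxx a).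

(* The matrix is the inverse of the Gram matrix of 1, x, a, xa, whose determinant
   is disc ^+ 2. *)
Definition quad_coords (z : C) : quad F :=
  let g0 := B z one / disc in let g1 := B z x / disc in
  let g2 := B z a / disc in let g3 := B z (x ** a) / disc in
  ((2 * N * M * g0 - T * M * g1 + m * g3, - (T * M) * g0 + 2 * M * g1 - m * g2),
   (- m * g1 + 2 * N * g2 - T * g3, m * g0 - T * g2 + 2 * g3)).

Hypothesis disc0 : disc != 0.

Lemma quad_evalK : cancel Q quad_coords.
Proof.
case=> [[c0 c1] [c2 c3]]; rewrite /quad_coords /quad_eval /= !polarE.
rewrite (polarC x one) (polarC a one) (polarC a x) !(polarC (x ** a)) !gramE.
by congr (_, _, (_, _)); field.
Qed.

(** The coordinates solve the Gram system, so [Q (quad_coords z)] is the orthogonal projection of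
    [z] onto the span. *)
Lemma quad_proj_orth z w :
  w \in [:: one; x; a; x ** a] -> B (z - Q (quad_coords z)) w = 0.
Proof.
rewrite !inE => /or4P[] /eqP->; rewrite /quad_coords /quad_eval /= !polarE.
all: rewrite ?(polarC x one) ?(polarC a one) ?(polarC a x) ?(polarC (x ** a)) ?gramE.
all: by field.
Qed.


Lemma quad_eval1 : Q (1, 0, (0, 0)) = one.
Proof. by rewrite /quad_eval !scale0r scale1r !addr0. Qed.
Lemma quad_evalx : Q (0, 1, (0, 0)) = x.
Proof. by rewrite /quad_eval !scale0r scale1r add0r !addr0. Qed.
Lemma quad_evala : Q (0, 0, (1, 0)) = a.
Proof. by rewrite /quad_eval !scale0r scale1r !add0r !addr0. Qed.
Lemma quad_evalxa : Q (0, 0, (0, 1)) = x ** a.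
Proof. by rewrite /quad_eval !scale0r scale1r !add0r. Qed.

Lemma quad_orth u :
  (forall w, w \in [:: one; x; a; x ** a] -> B u w = 0) -> forall c, B u (Q c) = 0.
Proof.
move=> h [[c0 c1] [c2 c3]]; rewrite /quad_eval !polarE !h ?inE ?eqxx ?orbT //.
by rewrite !mulr0 !addr0.
Qed.

Definition in_quad z := exists c, z = Q c.

Lemma in_quadM q r : in_quad q -> in_quad r -> in_quad (q ** r).
Proof. by move=> [c ->] [d ->]; eexists; apply: quad_evalM. Qed.
Lemma in_quad_conj q : in_quad q -> in_quad (conj q).
Proof. by move=> [c ->]; eexists; apply: quad_eval_conj. Qed.
Lemma in_quad1 : in_quad one.
Proof. by exists (1, 0, (0, 0)); rewrite quad_eval1. Qed.
Lemma in_quadZD (k : F) q r : in_quad q -> in_quad r -> in_quad (k *: q + r).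
Proof. by move=> [c ->] [d ->]; eexists; rewrite -quad_eval_linear. Qed.

Lemma quad_nondeg q : in_quad q -> (forall r, in_quad r -> B q r = 0) -> q = 0.
Proof.
move=> [c ->] h; rewrite -(quad_eval0 x a) -[c]quad_evalK /quad_coords.
have hB d : B (Q c) (Q d) = 0 by apply: h; exists d.
have := hB (1, 0, (0, 0)); have := hB (0, 1, (0, 0)).
have := hB (0, 0, (1, 0)); have := hB (0, 0, (0, 1)).
rewrite quad_eval1 quad_evalx quad_evala quad_evalxa => -> -> -> ->.
by rewrite !(mul0r, mulr0, subr0, addr0).
Qed.

(** * The double of the quaternion subalgebra is the whole algebra *)

Section DoubledQuaternion.

Variable b : C.
Hypothesis bQ : forall q, in_quad q -> B q b = 0.
Hypothesis nb0 : n b != 0.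
Local Notation E := (octuple_eval x a b).

Lemma octuple_evalM u v : E u ** E v = E (octuple_mul T N M m (n b) u v).
Proof.
case: u v => [c d] [c' d']; rewrite /octuple_eval /octuple_mul /=.
have inQ e : in_quad (Q e) by exists e.
rewrite mulDl !mulDr.
rewrite (doubling_mulQ in_quadM in_quad1 bQ) //.
rewrite (doubling_Qmul in_quad1 bQ) // (doubling_mul in_quadM in_quad_conj in_quad1 bQ) //.
rewrite !quad_eval_conj !quad_evalM.
rewrite !quad_evalD -scaleNr quad_evalZ mulDl.
linear_ring.
Qed.

(** Q is orthogonal to Qb, so the Q-component is orthogonal to Q and vanishes; right multiplication
    by [b] is injective because [n b] is nonzero. *)
Lemma octuple_eval_eq0 v : E v = 0 -> v = 0.
Proof.
case: v => [c d]; rewrite /octuple_eval /= => e.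
have inQ e' : in_quad (Q e') by exists e'.
have Qc0 : Q c = 0.
  apply: quad_nondeg => // r rQ.
  have := congr1 (B^~ r) e; rewrite polarDl polar0l [X in _ + X]polarC.
  by rewrite (doubling_polar in_quadM in_quad_conj bQ) // addr0.
move: e; rewrite Qc0 add0r => e.
have := mul_right_sq b (Q d); rewrite e mul0x scaler0 sub0r => /esym/eqP.
rewrite oppr_eq0 scaler_eq0 (negbTE nb0) => /eqP Qd0.
by rewrite -[c]quad_evalK -[d]quad_evalK Qc0 Qd0 -(quad_eval0 x a) !quad_evalK.
Qed.

Lemma octuple_eval_hom : exists h : 'Hom(octuple F, C),
  [/\ h =1 E, cancel h h^-1%VF & cancel h^-1%VF h].
Proof.
have [h hE] := hom_of_linear (octuple_eval_linear x a b); exists h.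
have [] // := @injective_hom_bijective _ _ _ h; first by rewrite dim_cayley.
by move=> u; rewrite hE => /octuple_eval_eq0.
Qed.

Lemma isotropic_orth z :
  z != 0 -> n z = 0 -> exists2 b', forall q, in_quad q -> B q b' = 0 & n b' = -1.
Proof.
have [h [hE _ hK]] := octuple_eval_hom.
rewrite -[z]hK hE; case: (h^-1%VF z) => [c d]; rewrite /octuple_eval /=.
have inQ e' : in_quad (Q e') by exists e'.
move=> z0; rewrite normD (doubling_polar in_quadM in_quad_conj bQ) // addr0 norm_mul => nz.
(* The vector is sought in the form sb, which is orthogonal to Q for every s in Q. *)
suff [s sQ ns] : exists2 s, in_quad s & n s = - (n b)^-1.
  exists (s ** b); first by move=> q qQ; rewrite (doubling_polar in_quadM in_quad_conj bQ).
  by rewrite norm_mul ns mulNr mulVf.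
(* Isotropy of [z] reads n(c) = - n(d) n(b). If n(d) is nonzero, the multiple of d conj(c) below has
   norm n(c) / (n(b)² n(d)) = - 1 / n(b). *)
have [nd0 | nd0] := eqVneq (n (Q d)) 0; last first.
  exists ((n b * n (Q d))^-1 *: (Q d ** conj (Q c)) + 0).
    by apply: in_quadZD; [apply: in_quadM; [|apply: in_quad_conj] | exists 0; rewrite quad_eval0].
  rewrite addr0 normZ norm_mul /conj normD normN normZ norm1 polarNr polarZl.
  have -> : n (Q c) = - (n (Q d) * n b) by apply/eqP; rewrite -addr_eq0 nz.
  by field; rewrite nb0 nd0.
have nc0 : n (Q c) = 0 by move: nz; rewrite nd0 mul0r addr0.
(* Otherwise both components of [z] are isotropic and one is nonzero. An isotropic [w] in Q with a
   partner [w'] not orthogonal to it makes the norm on Q universal: n(kw + w') = k n(w, w') +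
   n(w'). *)
have [w [wQ w0 nw]] : exists w, [/\ in_quad w, w <> 0 & n w = 0].
  have [c0 | c0] := eqVneq (Q c) 0; last by exists (Q c); split=> //; apply/eqP.
  exists (Q d); split=> // d0.
  by case/eqP: z0; rewrite c0 d0 mul0x addr0.
have [w' w'Q Bww'] : exists2 w', in_quad w' & B w w' != 0.
  apply: NNPP => nex; apply: w0; apply: quad_nondeg => // r rQ.
  by apply/eqP/negPn/negP => Br; apply: nex; exists r.
exists ((- ((n b)^-1 + n w') / B w w') *: w + w'); first exact: in_quadZD.
by rewrite normD normZ nw polarZl; field; rewrite nb0 Bww'.
Qed.

End DoubledQuaternion.

End Quaternion.

(** * Anisotropic vectors in orthogonal complements *)

(** Here [p] serves as orthogonal projection onto the span of [s]. A dimension count gives a nonzero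
    [u] orthogonal to [s]; some [w - p w], also orthogonal to [s], is not orthogonal to [u]. If both
    are isotropic, their sum is not. *)
Lemma exists_anisotropic_orth (s : seq C) (p : C -> C) : (size s < 8)%N ->
    (forall z w, w \in s -> B (z - p z) w = 0) ->
    (forall u z, (forall w, w \in s -> B u w = 0) -> B u (p z) = 0) ->
  exists2 b, forall w, w \in s -> B b w = 0 & n b != 0.
Proof.
move=> ss hp up.
pose f u : 'rV[F]_(size s) := \row_i B u s`_i.
have lf : linear f.
  by move=> k u v; apply/rowP => i; rewrite !mxE polarDl polarZl.
have [h hf] := hom_of_linear lf.
have [|u u0 hu] := @hom_kernel_nontrivial _ _ _ h.
  by rewrite dim_matrix mul1r dim_cayley.
have us w : w \in s -> B u w = 0.
  rewrite -index_mem => ws; have /rowP/(_ (Ordinal ws)) := hu.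
  by rewrite hf !mxE /= nth_index // -index_mem.
have [w Buw] : exists w, B u w <> 0.
  apply: NNPP => nex; case/eqP: u0; apply: nondeg => y.
  by apply: NNPP => By; apply: nex; exists y.
have Buw' : B u (w - p w) != 0 by rewrite polarDr polarNr up // subr0; apply/eqP.
have [nu | nu] := eqVneq (n u) 0; last by exists u.
have [nw | nw] := eqVneq (n (w - p w)) 0; last by exists (w - p w) => // *; apply: hp.
exists (u + (w - p w)); last by rewrite normD nu nw !add0r.
by move=> v vs; rewrite polarDl us // hp // addr0.
Qed.

Lemma quad_orth_anisotropic x a : t a = 0 ->
    (4 * n x - t x ^+ 2) * n a - B x a ^+ 2 != 0 ->
  exists2 b, forall q, in_quad x a q -> B q b = 0 & n b != 0.
Proof.
move=> ta disc0.
have [] := @exists_anisotropic_orth [:: one; x; a; x ** a]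
  (fun z => quad_eval x a (quad_coords x a z)) => //.
- exact: quad_proj_orth.
- by move=> u z us; apply: quad_orth.
by move=> b bs nb; exists b => // _ [c ->]; rewrite polarC quad_orth.
Qed.


Lemma exists_companion x : (forall k, x <> k *: one) ->
  exists2 a, t a = 0 & (4 * n x - t x ^+ 2) * n a - B x a ^+ 2 != 0.
Proof.
(* This quantity is the Gram determinant of 1, x. If it vanishes, a trace-zero [a] not orthogonal to
   [x] suffices; were there none, n(x, -) would be a multiple of the trace and [x] a scalar. *)
move=> xns; have [dx0 | dx] := eqVneq (4 * n x - t x ^+ 2) 0.
  have [w tw] : exists w, t w <> 0.
    apply: NNPP => nex; case/eqP: one_neq0; apply: nondeg => y.
    by apply: NNPP => ty; apply: nex; exists y.
  have [a Bxa ta] : exists2 a, B x a != 0 & t a = 0.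
    apply: NNPP => nex; apply: (xns (B x w / t w)); apply: polar_inj => z.
    rewrite polarZl; apply/eqP; rewrite -subr_eq0; apply/negPn/negP => nz.
    apply: nex; exists (z - (t z / t w) *: w); rewrite !polarE.
      by apply: contraNneq nz => <-; apply/eqP; field; apply/eqP.
    by field; apply/eqP.
  by exists a => //; rewrite dx0 mul0r sub0r oppr_eq0 expf_eq0.
pose D := 4 * n x - t x ^+ 2.
(* Orthogonal projection onto the plane of 1 and x, by the inverse of its Gram matrix. An
   anisotropic [a] orthogonal to that plane makes the discriminant equal to D n(a). *)
pose p z := ((2 * n x * B z one - t x * B z x) / D) *: one
          + ((2 * B z x - t x * B z one) / D) *: x.
have [] := @exists_anisotropic_orth [:: one; x] p.
- by [].
- move=> z w; rewrite !inE => /orP[] /eqP->; rewrite /p !polarE.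
    by rewrite (polarC x one) polar11 /D; field.
  by rewrite (polarxx x) /D; field.
- move=> u z us; rewrite /p !polarE (us one) ?(us x) ?inE ?eqxx ?orbT //.
  by rewrite !mulr0 addr0.
move=> a as0 na; exists a; first by rewrite polarC as0 ?inE ?eqxx.
by rewrite (polarC x a) (as0 x) ?inE ?eqxx ?orbT // expr0n subr0 mulf_neq0.
Qed.

(** * Automorphisms, isometries and reflections *)

Lemma automorphism_of_generators x a b y a' b' :
    t a = 0 -> (4 * n x - t x ^+ 2) * n a - B x a ^+ 2 != 0 ->
    (forall q, in_quad x a q -> B q b = 0) -> n b != 0 ->
    (forall q, in_quad y a' q -> B q b' = 0) ->
    t y = t x -> n y = n x -> t a' = t a -> n a' = n a -> B y a' = B x a ->
    n b' = n b ->
  exists phi, is_automorphism mul phi /\ phi x = y.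
Proof.
move=> ta disc0 bQ nb0 bQ' ty ny ta' na' Bya nb'.
have [h [hE hK Kh]] := octuple_eval_hom ta disc0 bQ nb0.
rewrite ta in ta'; rewrite -ty -ny -na' -Bya in disc0; rewrite -nb' in nb0.
have [h' [hE' hK' Kh']] := octuple_eval_hom ta' disc0 bQ' nb0.
have hM u v : h u ** h v = h (octuple_mul (t x) (n x) (n a) (B x a) (n b) u v).
  by rewrite !hE octuple_evalM.
have hM' u v : h' u ** h' v = h' (octuple_mul (t x) (n x) (n a) (B x a) (n b) u v).
  by rewrite !hE' octuple_evalM // ty ny na' Bya nb'.
exists (fun z => h' (h^-1%VF z)); split.
  split.
  - by move=> k u v; rewrite !linearP.
  - by exists (fun z => h (h'^-1%VF z)) => z; rewrite ?hK' ?Kh ?hK ?Kh'.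
  - by move=> u v; rewrite -{1}[u]Kh -{1}[v]Kh hM hK hM'.
have hx : h ((0, 1, (0, 0)), 0) = x.
  by rewrite hE /octuple_eval /= quad_evalx quad_eval0 mul0x addr0.
have -> : h^-1%VF x = ((0, 1, (0, 0)), 0) by rewrite -[x in LHS]hx hK.
by rewrite hE' /octuple_eval /= quad_evalx quad_eval0 mul0x addr0.
Qed.

Definition is_isometry (phi : C -> C) := is_linear phi /\ forall x, n (phi x) = n x.

Lemma isometry_polar phi x y : is_isometry phi -> B (phi x) (phi y) = B x y.
Proof.
case=> lin nphi; have := lin 1 x y; rewrite !scale1r /polar => <-.
by rewrite !nphi.
Qed.

(** Dividing by [n w], not by half of [polar n w w], keeps the formula meaningful in characteristic
    2, where it is an orthogonal transvection. *)
Definition reflection w z : C := z - (B z w / n w) *: w.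

Lemma reflection_isometry w : n w != 0 -> is_isometry (reflection w).
Proof.
move=> nw; split=> [k x y | x].
  by rewrite /reflection; linear_ring.
by rewrite /reflection normD normN normZ polarNr polarZr; field.
Qed.

Lemma reflection_swap u v :
  n u = n v -> n (u - v) != 0 -> reflection (u - v) u = v.
Proof.
move=> nuv nw; rewrite /reflection.
have -> : B u (u - v) = n (u - v).
  by rewrite normD normN !polarNr polarDr polarNr polarxx -nuv; ring.
by rewrite divff // scale1r subKr.
Qed.

Lemma automorphism_one phi : is_automorphism mul phi -> phi one = one.
Proof.
case=> _ [g gK Kg] phiM.
by rewrite -[LHS]mulx1 -{2}[one]Kg -phiM mul1x Kg.
Qed.

(** Comparing the image of the quadratic equation of [z] with that of [phi z] gives a linear
    relation between [phi z] and [one]. If the traces differ, [phi z] is a scalar, hence so is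
    [z]. *)
Lemma automorphism_norm phi z : is_automorphism mul phi -> n (phi z) = n z.
Proof.
move=> aut; have phi1 := automorphism_one aut.
case: aut => lin [g gK Kg] phiM.
have phiZ k u : phi (k *: u) = k *: phi u by apply: linear_mapZ.
have [[k ->] | zns] := classic (exists k, z = k *: one).
  by rewrite phiZ phi1.
have : phi (z ** z) = t z *: phi z - n z *: one.
  by rewrite mul_sq lin -scaleNr phiZ phi1 scaleNr.
rewrite phiM mul_sq => e.
have {}e : (t (phi z) - t z) *: phi z = (n (phi z) - n z) *: one by linear_ring_from e.
have [tz | tz] := eqVneq (t (phi z) - t z) 0.
  move/esym/eqP: e; rewrite tz scale0r scaler_eq0 (negbTE one_neq0) orbF subr_eq0.
  by move/eqP.
case: zns; exists ((n (phi z) - n z) / (t (phi z) - t z)).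
apply: (can_inj gK); rewrite phiZ phi1 mulrC -scalerA -e scalerA mulVf // scale1r //.
Qed.

Lemma isometry_bijective phi : is_isometry phi -> bijective phi.
Proof.
move=> iso; have [lin _] := iso; have [h hE] := hom_of_linear lin.
have [] := @injective_hom_bijective _ _ _ h erefl.
  move=> u; rewrite hE => phiu; apply: nondeg => y.
  by rewrite -(isometry_polar _ _ iso) phiu polar0l.
by move=> hK Kh; exists h^-1%VF => z; rewrite -hE.
Qed.

Lemma reflection_fix w z : B z w = 0 -> reflection w z = z.
Proof. by move=> zw; rewrite /reflection zw mul0r scale0r subr0. Qed.

Lemma isometry_comp phi psi :
  is_isometry phi -> is_isometry psi -> is_isometry (phi \o psi).
Proof.
move=> [linphi nphi] [linpsi npsi]; split=> [k x y | x] /=.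
  by rewrite linpsi linphi.
by rewrite nphi npsi.
Qed.

(* When the norm is anisotropic, the only obstruction is that phi (x a) may differ
   from phi x phi a; the reflection exchanging the two fixes 1, phi x and phi a. *)
Lemma isometry_adjust phi x a : (forall z, n z = 0 -> z = 0) -> t a = 0 ->
    is_isometry phi -> phi one = one ->
  exists psi, [/\ is_isometry psi, psi one = one, psi x = phi x, psi a = phi a &
                  psi (x ** a) = phi x ** phi a].
Proof.
move=> aniso ta iso phi1; set u := phi (x ** a); set v := phi x ** phi a.
have [uv | uv] := eqVneq u v; first by exists phi.
have nuv : n (u - v) != 0.
  by apply: contraNneq uv => /aniso/eqP; rewrite subr_eq0.
have Bphi := isometry_polar _ _ iso; have nphi := iso.2.
have tphi z : t (phi z) = t z by rewrite -[in LHS]phi1 Bphi.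
(* The polar values of xa with 1, x, a depend only on norms, traces and n(x, a), all preserved by
   [phi]; so [u] and [v] pair equally with 1, phi x, phi a. *)
have fix1 : B one (u - v) = 0.
  rewrite polarDr polarNr tphi /v ![t (_ ** _)]polarC !polar_adjl /conj !mulE !polarE.
  by rewrite !(polarC _ one) !tphi Bphi subrr.
have fixx : B (phi x) (u - v) = 0.
  rewrite polarDr polarNr Bphi -{1}[x]mulx1 -{1}[phi x]mulx1 !polar_mull.
  by rewrite nphi tphi subrr.
have fixa : B (phi a) (u - v) = 0.
  rewrite polarDr polarNr Bphi -{1}[a]mul1x -{1}[phi a]mul1x !polar_mulr.
  by rewrite nphi tphi subrr.
exists (reflection (u - v) \o phi); split; rewrite /= ?phi1.
- by apply: isometry_comp => //; apply: reflection_isometry.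
- exact: reflection_fix.
- exact: reflection_fix.
- exact: reflection_fix.
by rewrite -/u reflection_swap // /v norm_mul !nphi norm_mul.
Qed.

Lemma isometry_quad psi x a : is_linear psi -> psi one = one ->
    psi (x ** a) = psi x ** psi a ->
  forall c, psi (quad_eval x a c) = quad_eval (psi x) (psi a) c.
Proof.
move=> lin psi1 psixa [[c0 c1] [c2 c3]]; have [h hE] := hom_of_linear lin.
by rewrite -hE /quad_eval !linearD !linearZ /= !hE psi1 psixa.
Qed.

(** * Automorphisms agreeing with an isometry at a given vector *)

Lemma isometry_orbit phi x : is_isometry phi -> phi one = one ->
  exists f, is_automorphism mul f /\ f x = phi x.
Proof.
move=> iso phi1; have [lin nphi] := iso.
have [[k ->] | xns] := classic (exists k, x = k *: one).
  exists id; split; first by split=> //; exists id.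
  by rewrite (linear_mapZ _ _ lin) phi1.
have [|a ta disc0] := @exists_companion x; first by move=> k xk; apply: xns; exists k.
have Bphi := isometry_polar _ _ iso.
have tphi z : t (phi z) = t z by rewrite -[in LHS]phi1 Bphi.
have ta' : t (phi a) = 0 by rewrite tphi.
have disc0' : (4 * n (phi x) - t (phi x) ^+ 2) * n (phi a) - B (phi x) (phi a) ^+ 2 != 0.
  by rewrite tphi !nphi Bphi.
have [b0 b0Q nb0] := quad_orth_anisotropic ta disc0.
(* The same isotropic [z] is decomposed along both doubles, yielding orthogonal vectors of norm -1
   on each side. *)
have [[z [z0 nz]] | aniso] := classic (exists z, z <> 0 /\ n z = 0).
  move/eqP: z0 => z0.
  have [b bQ nb] := isotropic_orth ta disc0 b0Q nb0 z0 nz.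
  have [b0' b0Q' nb0'] := quad_orth_anisotropic ta' disc0'.
  have [b' bQ' nb'] := isotropic_orth ta' disc0' b0Q' nb0' z0 nz.
  apply: (automorphism_of_generators ta disc0 bQ _ bQ') => //.
    by rewrite nb oppr_eq0 oner_eq0.
  by rewrite nb.
have {}aniso z : n z = 0 -> z = 0.
  by move=> nz; apply: NNPP => z0; apply: aniso; exists z.
have [psi [[linpsi npsi] psi1 psix psia psixa]] := isometry_adjust x aniso ta iso phi1.
apply: (automorphism_of_generators (a := a) (a' := phi a) ta disc0 b0Q nb0 (b' := psi b0)) => //.
move=> _ [c ->]; rewrite -psix -psia -isometry_quad ?psix ?psia //.
by rewrite isometry_polar //; apply: b0Q; exists c.
Qed.

End CompositionAlgebra.

Theorem theorem3p2 (F : fieldType) (C : vectType F)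
    (mul : C -> C -> C) (one : C) (n : C -> F) :
  cayley_algebra mul one n ->
  forall psi : C -> C,
    is_local_automorphism mul psi <-> (in_orthogonal_group n psi /\ psi one = one).
Proof.
move=> cayley psi; split=> [[lin loc] | [[lin _ npsi] psi1]].
  (* Preserving the norm and fixing [one] are conditions on single vectors, so they pass from
     automorphisms to [psi]. *)
  have iso : is_isometry n psi.
    split=> // x; have [f [autf ->]] := loc x.
    by rewrite (automorphism_norm cayley _ autf).
  split; first by split=> //; [exact: (isometry_bijective cayley iso) | exact: iso.2].
  by have [f [autf ->]] := loc one; apply: (automorphism_one cayley autf).
split=> // x.
have [|f [autf fx]] := @isometry_orbit _ _ _ _ _ cayley psi x _ psi1; first by split.
by exists f.
Qed.
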